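(* Let $\mathbf{u}\in\mathbf{X}$ be a classical cycle for $\mathbf{f}$, i.e., $0\in\partial\mathbf{f}(\mathbf{u})+(\operatorname{Id}-\mathbf{R})\mathbf{u}$. Set $\mathbf{v}=-P_\Delta(\mathbf{u})\in\Delta$ and $\mathbf{x}=\mathbf{u}+\mathbf{v}=P_{\Delta^\perp}(\mathbf{u})$. Then: (i) $\mathbf{f}\Box\iota_\Delta$ is lower semicontinuous at $\mathbf{x}$ and exact at $\mathbf{x}$. (ii) $\mathbf{x}\in\Delta^\perp$ and $$0\in\partial(\mathbf{f}\Box\iota_\Delta)(\mathbf{x})+(\operatorname{Id}-\mathbf{R})\mathbf{x}=\partial[\operatorname{cl}(\mathbf{f}\Box\iota_\Delta)](\mathbf{x})+(\operatorname{Id}-\mathbf{R})\mathbf{x}.$$ Consequently, $\mathbf{x}$ is the generalized cycle for $\operatorname{cl}(\mathbf{f}\Box\iota_\Delta)$. (iii) $P_{\Delta^\perp}(\mathbf{Z})=\{\mathbf{x}\}$.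
   Context: $X$ is a real Hilbert space, $m\in\{1,2,\dots\}$, $\mathbf{X}=X^m$ is the product Hilbert space. $\Delta=\{(x,\dots,x): x\in X\}\subseteq\mathbf{X}$, $\Delta^\perp$ is its orthogonal complement, $P_\Delta,P_{\Delta^\perp}$ are the orthogonal projections, and $\mathbf{R}(x_1,\dots,x_m)=(x_m,x_1,\dots,x_{m-1})$. $f_1,\dots,f_m$ are proper lower semicontinuous convex functions $X\to\,]-\infty,+\infty]$, and $\mathbf{f}(x_1,\dots,x_m)=\sum_{i=1}^m f_i(x_i)$. $\iota_\Delta$ is the indicator function of $\Delta$; $(\mathbf{f}\Box\iota_\Delta)(\mathbf{x})=\inf_{\mathbf{w}\in\mathbf{X}}(\mathbf{f}(\mathbf{w})+\iota_\Delta(\mathbf{x}-\mathbf{w}))$ is the infimal convolution, exact at $\mathbf{x}$ if this infimum is attained; $\operatorname{cl}$ denotes the lower semicontinuous hull and $\partial$ the convex subdifferential. Standing assumption: $\operatorname{dom}\mathbf{f}^*\cap\Delta^\perp\neq\varnothing$ ($\mathbf{f}^*$ the Fenchel conjugate). $\mathbf{Z}=\{\mathbf{z}\in\mathbf{X}: 0\in\partial\mathbf{f}(\mathbf{z})+\mathbf{z}-\mathbf{R}\mathbf{z}\}$ is the set of classical cycles of $\mathbf{f}$. The generalized cycle of $\operatorname{cl}(\mathbf{f}\Box\iota_\Delta)$ is the unique solution $\mathbf{x}$ of: $0\in\partial[\operatorname{cl}(\mathbf{f}\Box\iota_\Delta)](\mathbf{x})+(\operatorname{Id}-\mathbf{R})\mathbf{x}$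 and $\mathbf{x}\in\Delta^\perp$. *)

(* Defs.v *)
From HB Require Import structures.
From mathcomp Require Import all_boot all_order all_algebra.
From mathcomp Require Import all_classical all_reals all_analysis.
From mathcomp Require Import ring lra.

Set Implicit Arguments.
Unset Strict Implicit.
Unset Printing Implicit Defensive.

Import Order.TTheory GRing.Theory Num.Theory.
Import numFieldNormedType.Exports.

Local Open Scope classical_set_scope.
Local Open Scope ring_scope.

HB.mixin Record CompleteNormedModule_isHilbert (R : realType) X
    & CompleteNormedModule R X := {
  inner : X -> X -> R;
  innerC : forall x y, inner x y = inner y x;
  innerDl : forall x y z, inner (x + y) z = inner x z + inner y z;
  innerZl : forall a x y, inner (a *: x) y = a * inner x y;
  inner_normE : forall x, inner x x = `|x| ^+ 2
}.

#[short(type="hilbertType")]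
HB.structure Definition Hilbert (R : realType) :=
  {X of CompleteNormedModule R X & CompleteNormedModule_isHilbert R X}.

Definition hpow (R : realType) (X : hilbertType R) (m : nat) : Type :=
  {ffun 'I_m -> X}.

Section ProductHilbert.
Context (R : realType) (X : hilbertType R) (m : nat).
Implicit Types x y z : hpow X m.

HB.instance Definition _ := GRing.Lmodule.copy (hpow X m) {ffun 'I_m -> X}.

Definition hpow_inner x y : R := \sum_i inner (x i) (y i).

Definition hpow_norm x : R := Num.sqrt (\sum_i `|x i| ^+ 2).

Lemma hpow_innerC x y : hpow_inner x y = hpow_inner y x.
Proof. by apply: eq_bigr => i _; rewrite innerC. Qed.

Lemma hpow_innerDl x y z :
  hpow_inner (x + y) z = hpow_inner x z + hpow_inner y z.
Proof. by rewrite -big_split; apply: eq_bigr => i _; rewrite ffunE innerDl. Qed.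

Lemma hpow_innerZl a x y : hpow_inner (a *: x) y = a * hpow_inner x y.
Proof. by rewrite mulr_sumr; apply: eq_bigr => i _; rewrite ffunE innerZl. Qed.

Lemma hpow_sqr_ge0 x : 0 <= \sum_i `|x i| ^+ 2.
Proof. by apply: sumr_ge0 => i _; exact: sqr_ge0. Qed.

#[local] Hint Resolve hpow_sqr_ge0 : core.

Lemma hpow_inner_normE x : hpow_inner x x = hpow_norm x ^+ 2.
Proof.
by rewrite sqr_sqrtr//; apply: eq_bigr => i _; rewrite inner_normE.
Qed.

Lemma hpow_norm_ge0 x : 0 <= hpow_norm x.
Proof. exact: sqrtr_ge0. Qed.

#[local] Hint Resolve hpow_norm_ge0 : core.

Lemma hpow_le_norm x i : `|x i| <= hpow_norm x.
Proof.
rewrite -(@ler_pXn2r _ 2)// ?nnegrE// sqr_sqrtr// (bigD1 i)//= lerDl.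
by apply: sumr_ge0 => j _; exact: sqr_ge0.
Qed.

Lemma hpow_normr0_eq0 x : hpow_norm x = 0 -> x = 0.
Proof.
move=> x0; apply/ffunP => i; apply/eqP; rewrite ffunE -normr_eq0.
by rewrite eq_le normr_ge0 andbT -x0 hpow_le_norm.
Qed.

Lemma hpow_normrZ (a : R) x : hpow_norm (a *: x) = `|a| * hpow_norm x.
Proof.
apply/eqP; rewrite -(@eqrXn2 _ 2)// ?mulr_ge0//.
rewrite -hpow_inner_normE hpow_innerZl hpow_innerC hpow_innerZl.
by rewrite hpow_inner_normE exprMn real_normK ?num_real// mulrA expr2.
Qed.

Lemma hpow_CS x y : hpow_inner x y <= hpow_norm x * hpow_norm y.
Proof.
have [y0|y0] := eqVneq (hpow_norm y) 0.
  have -> : y = 0 *: y by rewrite scale0r; exact: hpow_normr0_eq0.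
  by rewrite hpow_innerC hpow_innerZl mul0r mulr_ge0.
have [x0|x0] := eqVneq (hpow_norm x) 0.
  have -> : x = 0 *: x by rewrite scale0r; exact: hpow_normr0_eq0.
  by rewrite hpow_innerZl mul0r mulr_ge0.
have nx : 0 < hpow_norm x by rewrite lt_neqAle eq_sym x0 hpow_norm_ge0.
have ny : 0 < hpow_norm y by rewrite lt_neqAle eq_sym y0 hpow_norm_ge0.
set a := hpow_norm x in nx *; set b := hpow_norm y in ny *.
have : 0 <= hpow_inner (b *: x + (- a) *: y) (b *: x + (- a) *: y).
  by rewrite hpow_inner_normE sqr_ge0.
rewrite !(hpow_innerDl, hpow_innerZl).
rewrite !(hpow_innerC _ (_ + _)) !(hpow_innerDl, hpow_innerZl).
rewrite !hpow_inner_normE -/a -/b (hpow_innerC y x).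
set c := hpow_inner x y => h.
have : 0 <= (2 * (a * b)) * (a * b - c) by lra.
by rewrite pmulr_rge0 ?subr_ge0// !mulr_gt0.
Qed.

Lemma hpow_ler_normD x y : hpow_norm (x + y) <= hpow_norm x + hpow_norm y.
Proof.
rewrite -(@ler_pXn2r _ 2)// ?nnegrE ?addr_ge0// -hpow_inner_normE.
rewrite hpow_innerDl !(hpow_innerC _ (_ + _)) !hpow_innerDl !hpow_inner_normE.
rewrite (hpow_innerC y x) sqrrD mulr2n.
by have := hpow_CS x y; lra.
Qed.

HB.instance Definition _ := Lmodule_isNormed.Build R (hpow X m)
  hpow_ler_normD hpow_normrZ hpow_normr0_eq0.

Lemma hpow_normE x : `|x| = hpow_norm x. Proof. by []. Qed.

Lemma hpow_norm_le_sum x : `|x| <= \sum_i `|x i|.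
Proof.
rewrite hpow_normE -(@ler_pXn2r _ 2)// ?nnegrE ?sumr_ge0// sqr_sqrtr//.
rewrite expr2 mulr_suml; apply: ler_sum => i _.
rewrite expr2 ler_wpM2l// (bigD1 i)//= lerDl.
exact: sumr_ge0.
Qed.

Lemma hpow_complete (F : set_system (hpow X m)) :
  ProperFilter F -> cauchy F -> cvg F.
Proof.
move=> FF /cauchy_ballP Fc.
have cvgi (i : 'I_m) : cvg ((fun x : hpow X m => x i) @ F).
  apply: cauchy_cvg; apply/cauchy_ballP => e e0.
  have := Fc _ e0; rewrite !near_simpl => -[[A B] /= [FA FB] AB].
  exists ((fun x : hpow X m => x i) @` A, (fun x : hpow X m => x i) @` B).
    by split; [apply: filterS FA | apply: filterS FB] => z zA; exists z.
  move=> [_ _] /= [[x Ax <-] [y By <-]].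
  have := AB (x, y) (conj Ax By); rewrite /= -!ball_normE /=.
  apply: le_lt_trans.
  have -> : x i - y i = (x - y) i by rewrite !ffunE.
  exact: hpow_le_norm.
pose l : hpow X m := [ffun i => lim ((fun x : hpow X m => x i) @ F)].
apply/cvg_ex; exists l; apply/cvgrPdist_lt => e e0.
have d0 : 0 < e / m.+1%:R by rewrite divr_gt0.
have H (i : 'I_m) : F [set x : hpow X m | `|l i - x i| < e / m.+1%:R].
  have /cvgrPdist_lt := cvgi i; move/(_ _ d0).
  by rewrite /l ffunE.
have : F [set x : hpow X m | forall i, `|l i - x i| < e / m.+1%:R].
  exact: filter_forall.
apply: filterS => x lx.
apply: (le_lt_trans (hpow_norm_le_sum _)).
apply: (@le_lt_trans _ _ (\sum_(i < m) e / m.+1%:R)).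
  apply: ler_sum => i _; apply: ltW.
  have -> : (l - x) i = l i - x i by rewrite !ffunE.
  exact: lx.
rewrite sumr_const card_ord -[X in X < _]mulr_natl mulrCA gtr_pMr//.
by rewrite ltr_pdivrMr// mul1r ltr_nat.
Qed.

HB.instance Definition _ := Uniform_isComplete.Build (hpow X m) hpow_complete.

HB.instance Definition _ := CompleteNormedModule_isHilbert.Build R (hpow X m)
  hpow_innerC hpow_innerDl hpow_innerZl hpow_inner_normE.

End ProductHilbert.

Section HilbertGeometry.
Context (R : realType) (H : hilbertType R).
Implicit Types (C : set H) (x y u : H).

Definition orthogonal_complement C : set H :=
  [set y | forall c, C c -> inner c y = 0].

(* The orthogonal projection onto a closed linear subspace [C]: the only
   [p] in [C] such that [x - p] is orthogonal to [C]. *)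
Definition orthoproj C x : H :=
  xget 0 [set p | C p /\ orthogonal_complement C (x - p)].

End HilbertGeometry.

Section ConvexAnalysis.
Context (R : realType) (H : hilbertType R).
Implicit Types (f g : H -> \bar R) (C : set H) (x y u w : H).
Local Open Scope ereal_scope.

Definition effective_domain f : set H := [set x | f x < +oo].

Definition proper_efun f : Prop :=
  (forall x, -oo < f x) /\ effective_domain f !=set0.

(* Meaningful for functions that do not take the value [-oo]. *)
Definition convex_efun f : Prop :=
  forall x y (t : R), (0 < t < 1)%R ->
    f (t *: x + (1 - t) *: y)%R <= t%:E * f x + (1 - t)%:E * f y.

Definition lower_semicontinuous_at f x : Prop :=
  forall a : R, a%:E < f x -> \forall y \near x, a%:E < f y.

Definition lsc_hull f x : \bar R :=
  ereal_sup [set g x | g in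
    [set g | lower_semicontinuous g /\ forall y, g y <= f y]].

Definition indicator_fun C x : \bar R := if x \in C then 0 else +oo.

Definition infconv f g x : \bar R :=
  ereal_inf (range (fun w => f w + g (x - w)%R)).

Definition infconv_exact_at f g x : Prop :=
  exists w, f w + g (x - w)%R = infconv f g x.

Definition fenchel_conjugate f u : \bar R :=
  ereal_sup (range (fun x => (inner x u)%:E - f x)).

Definition subdifferential f x : set H :=
  [set u | forall y, f x + (inner (y - x) u)%:E <= f y].

End ConvexAnalysis.

Section Cycles.
Context (R : realType) (X : hilbertType R) (m : nat).
Local Notation XX := (hpow X m).

Definition diagonal_subspace : set XX :=
  range (fun x : X => [ffun => x] : XX).

(* Indices are cyclic: [ord_pred] sends the first index to the last one. *)
Definition right_shift (x : XX) : XX := [ffun i => x (ord_pred i)].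

Definition separable_sum (f : 'I_m -> X -> \bar R) (x : XX) : \bar R :=
  (\sum_i f i (x i))%E.

Definition cycle_operator (F : XX -> \bar R) (x : XX) : set XX :=
  [set u + (x - right_shift x) | u in subdifferential F x].

Definition classical_cycles (F : XX -> \bar R) : set XX :=
  [set z | cycle_operator F z 0].

(* [x] is the unique solution of the system defining generalized cycles. *)
Definition is_generalized_cycle (F : XX -> \bar R) (x : XX) : Prop :=
  [set y | cycle_operator F y 0 /\ orthogonal_complement diagonal_subspace y]
    = [set x].

End Cycles.

Arguments diagonal_subspace {R} X m.

(* Main.v *)
Require Import Defs.
From mathcomp Require Import all_boot all_order all_algebra.
From mathcomp Require Import all_classical all_reals all_analysis.
From mathcomp Require Import ring lra.

(** Let [D] be the diagonal.  A classical cycle [u] comes with the subgradient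
    [p = R u - u] of [f] at [u], and [p] is orthogonal to [D] because the
    circular shift [R] preserves the sum of the components.  An affine
    minorant of [f] with slope [p] is constant along [D]-translates, so it
    also minorizes the infimal convolution [F] of [f] with the indicator of
    [D].  Moreover [F x <= f u], since [x - u] lies in [D].  Hence
    [F x = f u], the infimum is attained at [u], and [p] is a subgradient of
    [F] at [x] ([subdifferential_infconv]).

    Everything about lower semicontinuity then follows from the existence of
    one subgradient at [x]: the corresponding affine function is continuous,
    lies below [F] and touches it at [x], so it forces [F] to be lower
    semicontinuous at [x] and to agree there with its hull, with the same
    subgradients ([lower_semicontinuous_at_subgradient],
    [subdifferential_lsc_hull]).  As [R] fixes [D] pointwise, [p = R x - x],
    so [x] solves the inclusion that defines generalized cycles.

    Uniqueness rests on the isometry of [R]: if [x] and [y] both solve that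
    inclusion for some function, monotonicity of the subdifferential gives
    [<d, R d - d> >= 0] for [d = x - y], while
    [|R d - d|^2 = - 2 <d, R d - d>]; so [R d = d] and [d] lies in [D]
    ([cycles_differ_by_diagonal]).  When [x] and [y] are in the orthogonal
    complement of [D], so is [d], and [d = 0].  Since
    every classical cycle projects onto such an [x], the same uniqueness shows
    that all classical cycles have the same projection. *)

Import Order.TTheory GRing.Theory Num.Theory.
Import numFieldNormedType.Exports.

Local Open Scope classical_set_scope.
Local Open Scope ring_scope.

(** * Inner products and orthogonal projections *)

Section HilbertGeometry.
Set Implicit Arguments.
Unset Strict Implicit.
Context {R : realType} {H : hilbertType R}.
Implicit Types (C : set H) (a : R) (x y z p : H).

Lemma innerDr x y z : inner x (y + z) = inner x y + inner x z.
Proof. by rewrite !(innerC x) innerDl. Qed.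

Lemma inner0l x : inner 0 x = 0.
Proof. by rewrite -[0 in LHS](scale0r x) innerZl mul0r. Qed.

Lemma inner0r x : inner x 0 = 0.
Proof. by rewrite innerC inner0l. Qed.

Lemma innerNl x y : inner (- x) y = - inner x y.
Proof. by rewrite -scaleN1r innerZl mulN1r. Qed.

Lemma innerNr x y : inner x (- y) = - inner x y.
Proof. by rewrite !(innerC x) innerNl. Qed.

Lemma innerBl x y z : inner (x - y) z = inner x z - inner y z.
Proof. by rewrite innerDl innerNl. Qed.

Lemma innerBr x y z : inner x (y - z) = inner x y - inner x z.
Proof. by rewrite innerDr innerNr. Qed.

Lemma inner_eq0 x : inner x x = 0 -> x = 0.
Proof. by rewrite inner_normE => /eqP; rewrite sqrf_eq0 normr_eq0 => /eqP. Qed.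

(** Polarization reduces this to the continuity of the norm. *)
Lemma inner_continuous p : continuous (fun y : H => inner y p).
Proof.
have polarization y :
    inner y p = 4^-1 * (`|y + p| * `|y + p| - `|y - p| * `|y - p|).
  rewrite -!expr2 -!inner_normE !(innerDl, innerDr, innerNl, innerNr).
  by rewrite (innerC p y); field.
under eq_fun do rewrite polarization.
move=> y; apply: cvgM; first exact: cvg_cst.
have normD_cvg z : `|t + z| @[t --> y] --> `|y + z|.
  by apply: cvg_norm; apply: cvgD; [exact: cvg_id|exact: cvg_cst].
by apply: cvgB; apply: cvgM; exact: normD_cvg.
Qed.

Lemma orthogonal_complementB C x y :
  orthogonal_complement C x -> orthogonal_complement C y ->
  orthogonal_complement C (x - y).
Proof. by move=> Cx Cy c Cc; rewrite innerBr Cx// Cy// subr0. Qed.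

Lemma orthogonal_complement_disjoint C x :
  C x -> orthogonal_complement C x -> x = 0.
Proof. by move=> Cx /(_ x Cx) /inner_eq0. Qed.

Lemma orthoproj_unique C x p :
  (forall y z, C y -> C z -> C (y - z)) ->
  C p -> orthogonal_complement C (x - p) -> orthoproj C x = p.
Proof.
move=> CB Cp xp; apply: xget_unique => // q [Cq xq]; apply/esym/eqP.
rewrite -subr_eq0; apply/eqP/(orthogonal_complement_disjoint (CB _ _ Cp Cq)).
have -> : p - q = (x - q) - (x - p) by rewrite opprB [RHS]addrC subrKA.
exact: orthogonal_complementB.
Qed.

(** The residual [x - (x - p) = p] lies in [C],
    hence in the biorthogonal of [C]. *)
Lemma orthoproj_complement C x p :
  C p -> orthogonal_complement C (x - p) ->
  orthoproj (orthogonal_complement C) x = x - p.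
Proof.
move=> Cp xp; apply: orthoproj_unique => //; first exact: orthogonal_complementB.
by move=> c Cc; rewrite subKr innerC; exact: Cc.
Qed.

End HilbertGeometry.

(** * Subgradients and lower semicontinuous hulls *)

Section Subgradients.
Set Implicit Arguments.
Unset Strict Implicit.
Context {R : realType} {H : hilbertType R}.
Implicit Types (f g : H -> \bar R) (C : set H) (x y u p q : H) (c : R).
Local Open Scope ereal_scope.

Lemma subdifferential_fin_num f x p :
  proper_efun f -> subdifferential f x p -> f x \is a fin_num.
Proof.
move=> [fNy [y yfin]] /(_ y) fxy; rewrite fin_numElt fNy/= ltey.
by apply: contraTneq (le_lt_trans fxy yfin) => ->; rewrite addye// ltxx.
Qed.

Lemma subdifferential_monotone f x y p q :
  f x \is a fin_num -> subdifferential f x p -> subdifferential f y q ->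
  (0 <= inner (x - y) (p - q))%R.
Proof.
move=> fx /(_ y) fp /(_ x); move: fp.
rewrite -(fineK fx) -[(y - x)%R]opprB innerNl innerBr.
case: (f y) => [b| |]//=.
by rewrite -!EFinD !lee_fin; lra.
Qed.

Lemma affine_lower_semicontinuous c x p :
  lower_semicontinuous (fun y => c%:E + (inner (y - x) p)%:E).
Proof.
move=> y a; rewrite -EFinD lte_fin => ay.
exists [set z | (a < c + inner (z - x) p)%R]; last first.
  by move=> z; rewrite -EFinD lte_fin.
have : (fun z => c + inner (z - x) p)%R @ y --> (c + inner (y - x) p)%R.
  under eq_fun do rewrite innerBl.
  rewrite innerBl; apply: cvgD; first exact: cvg_cst.
  by apply: cvgB; [exact: inner_continuous|exact: cvg_cst].
by move=> /cvgr_gt; apply.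
Qed.

(** The affine minorant given by the subgradient is continuous and agrees with
    [f] at [x]. *)
Lemma lower_semicontinuous_at_subgradient f x p :
  f x \is a fin_num -> subdifferential f x p -> lower_semicontinuous_at f x.
Proof.
move=> fx fp a ax.
have [] := @affine_lower_semicontinuous (fine (f x)) x p x a.
  by rewrite subrr inner0l adde0 fineK.
move=> V Vx aV; apply: filterS Vx => y /aV; rewrite fineK// => /lt_le_trans.
by apply; exact: fp.
Qed.

Lemma lsc_hull_le f x : lsc_hull f x <= f x.
Proof. by apply: ge_ereal_sup => _ [g [_ gf] <-]; exact: gf. Qed.

Lemma le_lsc_hull f g x :
  lower_semicontinuous g -> (forall y, g y <= f y) -> g x <= lsc_hull f x.
Proof. by move=> glsc gf; apply: ereal_sup_ubound; exists g. Qed.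

(** The affine minorant is one of the lower semicontinuous functions over
    which the hull is a supremum. *)
Lemma subgradient_le_lsc_hull f x p y :
  f x \is a fin_num -> subdifferential f x p ->
  f x + (inner (y - x) p)%:E <= lsc_hull f y.
Proof.
move=> fx fp; rewrite -(fineK fx).
apply: (@le_lsc_hull _ (fun z => (fine (f x))%:E + (inner (z - x) p)%:E)).
  exact: affine_lower_semicontinuous.
by move=> z; rewrite fineK//; exact: fp.
Qed.

Lemma lsc_hull_subgradient f x p :
  f x \is a fin_num -> subdifferential f x p -> lsc_hull f x = f x.
Proof.
move=> fx fp; apply/eqP; rewrite eq_le lsc_hull_le/=.
have := subgradient_le_lsc_hull x fx fp.
by rewrite subrr inner0l adde0.
Qed.

Lemma subdifferential_lsc_hull f x p :
  f x \is a fin_num -> subdifferential f x p ->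
  subdifferential (lsc_hull f) x = subdifferential f x.
Proof.
move=> fx fp; apply/seteqP; split => q fq y.
  have := fq y; rewrite (lsc_hull_subgradient fx fp) => /le_trans; apply.
  exact: lsc_hull_le.
by rewrite (lsc_hull_subgradient fx fp); exact: subgradient_le_lsc_hull.
Qed.

(** A slope orthogonal to [C] does not see translations by [C], so the affine
    minorant of [f] at [u] still minorizes the infimal convolution. *)
Lemma subgradient_le_infconv f C u p y :
  f u \is a fin_num -> subdifferential f u p -> orthogonal_complement C p ->
  f u + (inner (y - u) p)%:E <= infconv f (indicator_fun C) y.
Proof.
move=> fu fp Cp; apply: le_ereal_inf_tmp => _ [w _ <-].
rewrite /indicator_fun; have := fp w; case: ifPn => [/set_mem Cyw|_].
  rewrite adde0; have -> : (y - u = (y - w) + (w - u))%R by rewrite addrA subrK.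
  by rewrite (innerDl (y - w)) (Cp _ Cyw) add0r.
by rewrite -(fineK fu); case: (f w) => [b| |]//=; rewrite ?leey.
Qed.

Lemma infconv_le f C u x :
  C (x - u)%R -> infconv f (indicator_fun C) x <= f u.
Proof.
move=> Cxu; apply: ereal_inf_lbound; exists u => //.
by rewrite /indicator_fun mem_set// adde0.
Qed.

Lemma infconv_subgradient f C u x p :
  f u \is a fin_num -> subdifferential f u p -> orthogonal_complement C p ->
  C (x - u)%R -> infconv f (indicator_fun C) x = f u.
Proof.
move=> fu fp Cp Cxu; apply/eqP; rewrite eq_le infconv_le//=.
by have := subgradient_le_infconv x fu fp Cp; rewrite Cp// adde0.
Qed.

Lemma subdifferential_infconv f C u x p :
  f u \is a fin_num -> subdifferential f u p -> orthogonal_complement C p ->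
  C (x - u)%R -> subdifferential (infconv f (indicator_fun C)) x p.
Proof.
move=> fu fp Cp Cxu y; rewrite (infconv_subgradient fu fp Cp Cxu).
have -> : (inner (y - x) p = inner (y - u) p)%R.
  have -> : (y - u = (y - x) + (x - u))%R by rewrite addrA subrK.
  by rewrite (innerDl (y - x)) (Cp _ Cxu) addr0.
exact: subgradient_le_infconv.
Qed.

End Subgradients.

(** * The diagonal and the circular shift *)

Section CircularShift.
Set Implicit Arguments.
Unset Strict Implicit.
Context {R : realType} {X : hilbertType R} {m : nat}.
Local Notation XX := (hpow X m).
Local Notation diag := (diagonal_subspace X m).
Implicit Types (x y z d p : XX).

Lemma hpow_innerE x y : inner x y = \sum_i inner (x i) (y i).
Proof. by []. Qed.

Lemma diagonalB x y : diag x -> diag y -> diag (x - y).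
Proof.
move=> [a _ <-] [b _ <-]; exists (a - b) => //.
by apply/ffunP => i; rewrite !ffunE.
Qed.

Lemma diagonalN x : diag x -> diag (- x).
Proof.
by move=> [a _ <-]; exists (- a) => //; apply/ffunP => i; rewrite !ffunE.
Qed.

(** The projection onto the diagonal replaces each component by the mean. *)
Lemma exists_diagonal_component x :
  (0 < m)%N -> exists2 p, diag p & orthogonal_complement diag (x - p).
Proof.
move=> m0; pose a := m%:R^-1 *: \sum_i x i.
exists [ffun=> a]; first by exists a.
move=> _ [b _ <-]; rewrite hpow_innerE.
under eq_bigr do rewrite !ffunE innerBr.
rewrite sumrB sumr_const card_ord -(big_morph _ (innerDr b) (inner0r b)).
rewrite [inner b a]innerC innerZl -[X in _ - X]mulr_natl mulrA mulfV.
  by rewrite mul1r innerC subrr.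
by rewrite pnatr_eq0 -lt0n.
Qed.

Lemma diagonal_orthoproj x :
  (0 < m)%N -> diag (orthoproj diag x) /\
    orthogonal_complement diag (x - orthoproj diag x).
Proof.
move=> m0; have [p Dp xp] := exists_diagonal_component x m0.
by rewrite (orthoproj_unique _ Dp xp)//; exact: diagonalB.
Qed.

Lemma right_shiftB x y : right_shift (x - y) = right_shift x - right_shift y.
Proof. by apply/ffunP => i; rewrite !ffunE. Qed.

Lemma right_shift_diagonal d : diag d -> right_shift d = d.
Proof. by move=> [a _ <-]; apply/ffunP => i; rewrite !ffunE. Qed.

Lemma right_shift_isometry x y : inner (right_shift x) (right_shift y) = inner x y.
Proof.
rewrite !hpow_innerE [RHS](reindex_inj (@ord_pred_inj m)).
by apply: eq_bigr => i _; rewrite !ffunE.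
Qed.

(** Any two positions are joined by repeated cyclic predecessors. *)
Lemma right_shift_fixed d : (0 < m)%N -> right_shift d = d -> diag d.
Proof.
move=> m0 Rd; exists (d (Ordinal m0)) => //; apply/ffunP => i; rewrite ffunE.
case: i => k; elim: k => [|k IHk] km; first by congr (d _); exact: val_inj.
rewrite (IHk (ltnW km)) -[in RHS]Rd ffunE; congr (d _); apply: val_inj => /=.
by rewrite modnDr modn_small// ltnW.
Qed.

(** By isometry, pairing with a diagonal vector is the same before and after
    the shift. *)
Lemma right_shift_sub_orthogonal x :
  orthogonal_complement diag (right_shift x - x).
Proof.
move=> d Dd; rewrite innerBr -{1}(right_shift_diagonal Dd).
by rewrite right_shift_isometry subrr.
Qed.

Lemma cycle_operator0 (F : XX -> \bar R) x :
  cycle_operator F x 0 <-> subdifferential F x (right_shift x - x).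
Proof.
split=> [[p Fp /eqP]|Fp]; last by exists (right_shift x - x);
  rewrite ?subrKA ?subrr.
by rewrite addr_eq0 opprB => /eqP <-.
Qed.

(** An isometry satisfies [|R d - d|^2 = - 2 <d, R d - d>]. *)
Lemma right_shift_fixed_of_ge0 d :
  0 <= inner d (right_shift d - d) -> right_shift d = d.
Proof.
move=> dRd; apply/eqP; rewrite -subr_eq0; apply/eqP/inner_eq0.
have : inner (right_shift d - d) (right_shift d - d)
    = - (2 * inner d (right_shift d - d)).
  rewrite !(innerBl, innerBr) right_shift_isometry (innerC (right_shift d) d).
  by ring.
have : 0 <= inner (right_shift d - d) (right_shift d - d).
  by rewrite inner_normE sqr_ge0.
by lra.
Qed.

(** Monotonicity of the subdifferential of [F] bounds
    [<x - y, R (x - y) - (x - y)>] from below by [0], which the isometry [R]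
    only allows when [R] fixes [x - y]. *)
Lemma cycles_differ_by_diagonal (F : XX -> \bar R) x y :
  (0 < m)%N -> F x \is a fin_num ->
  cycle_operator F x 0 -> cycle_operator F y 0 -> diag (x - y).
Proof.
move=> m0 Fx /cycle_operator0 Fp /cycle_operator0 Fq.
apply: right_shift_fixed => //; apply: right_shift_fixed_of_ge0.
have := subdifferential_monotone Fx Fp Fq.
rewrite right_shiftB; congr (_ <= inner _ _).
by rewrite !opprB addrACA [RHS]addrACA [- x - _]addrC.
Qed.

End CircularShift.

(** * From classical cycles to generalized cycles *)

Section Cycles.
Set Implicit Arguments.
Unset Strict Implicit.
Context {R : realType} {X : hilbertType R} {m : nat}.
Context (f : 'I_m -> X -> \bar R)
  (f_proper : forall i, proper_efun (f i)).
Local Notation XX := (hpow X m).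
Local Notation diag := (diagonal_subspace X m).
Local Notation S := (separable_sum f).
Local Notation F := (infconv S (indicator_fun diag)).
Implicit Types (u z x : XX).

Lemma separable_sum_proper : proper_efun S.
Proof.
split=> [x|].
  rewrite ltNye; apply/eqP => /esum_eqNyP[i [_ _ fi]].
  by have := (f_proper i).1 (x i); rewrite fi.
have [a fa] := choice (fun i => (f_proper i).2).
exists [ffun i => a i]; apply: lte_sum_pinfty => i _.
by rewrite ffunE; exact: fa.
Qed.

Lemma classical_cycleE z :
  classical_cycles S z -> S z \is a fin_num /\
    subdifferential S z (right_shift z - z).
Proof.
move=> /cycle_operator0 Sp; split=> //.
exact: subdifferential_fin_num separable_sum_proper Sp.
Qed.

Lemma infconv_classical_cycle u x :
  classical_cycles S u -> diag (x - u) -> F x = S u.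
Proof.
move=> /classical_cycleE[Su Sp].
by apply: infconv_subgradient Sp _ => //; exact: right_shift_sub_orthogonal.
Qed.

(** The shift fixes the diagonal vector [x - u], so [R x - x = R u - u]: the
    subgradient inherited from [u] is the one required at [x]. *)
Lemma cycle_operator_infconv u x :
  classical_cycles S u -> diag (x - u) -> cycle_operator F x 0.
Proof.
move=> /classical_cycleE[Su Sp] Dxu; apply/cycle_operator0.
have -> : right_shift x - x = right_shift u - u.
  apply/eqP; rewrite -subr_eq0 opprB [u - _]addrC addrACA -right_shiftB.
  by rewrite (right_shift_diagonal Dxu) [- x + u]addrC subrKA subrr.
apply: subdifferential_infconv Sp _ Dxu => //.
exact: right_shift_sub_orthogonal.
Qed.

Lemma cycle_operator_lsc_hull u x :
  classical_cycles S u -> diag (x - u) ->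
  cycle_operator (lsc_hull F) x = cycle_operator F x.
Proof.
move=> Zu Dxu; have /cycle_operator0 Fp := cycle_operator_infconv Zu Dxu.
rewrite /cycle_operator (subdifferential_lsc_hull _ Fp)//.
by rewrite (infconv_classical_cycle Zu Dxu) (classical_cycleE Zu).1.
Qed.

Lemma generalized_cycle_lsc_hull u x :
  (0 < m)%N -> classical_cycles S u -> diag (x - u) ->
  orthogonal_complement diag x -> is_generalized_cycle (lsc_hull F) x.
Proof.
move=> m0 Zu Dxu Dx.
have Fx0 := cycle_operator_infconv Zu Dxu.
have Fx : F x \is a fin_num.
  by rewrite (infconv_classical_cycle Zu Dxu) (classical_cycleE Zu).1.
have clx0 : cycle_operator (lsc_hull F) x 0.
  by rewrite (cycle_operator_lsc_hull Zu Dxu).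
have clFx : lsc_hull F x \is a fin_num.
  by rewrite (lsc_hull_subgradient Fx (iffLR (cycle_operator0 _ _) Fx0)).
apply/seteqP; split => [y [cly0 Dy]|_ ->]//=.
apply/esym/eqP; rewrite -subr_eq0; apply/eqP.
apply: (@orthogonal_complement_disjoint _ _ diag).
  exact: cycles_differ_by_diagonal clFx clx0 cly0.
exact: orthogonal_complementB.
Qed.

End Cycles.

Theorem theorem4p4 (R : realType) (X : hilbertType R) (m : nat) (hm : (0 < m)%N)
  (f : 'I_m -> X -> \bar R)
  (f_proper : forall i, proper_efun (f i))
  (f_lsc : forall i, lower_semicontinuous (f i))
  (f_convex : forall i, convex_efun (f i))
  (hdom : effective_domain (fenchel_conjugate (separable_sum f))
            `&` orthogonal_complement (diagonal_subspace X m) !=set0)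
  (u v x : hpow X m)
  (hu : classical_cycles (separable_sum f) u)
  (hv : v = - orthoproj (diagonal_subspace X m) u)
  (hx : x = u + v) :
  let F := infconv (separable_sum f) (indicator_fun (diagonal_subspace X m)) in
  [/\ (* the assertions made when v and x are introduced *)
      diagonal_subspace X m v /\
      x = orthoproj (orthogonal_complement (diagonal_subspace X m)) u,
      (* (i) *)
      lower_semicontinuous_at F x /\
      infconv_exact_at (separable_sum f) (indicator_fun (diagonal_subspace X m)) x,
      (* (ii) *)
      [/\ orthogonal_complement (diagonal_subspace X m) x,
          cycle_operator F x 0,
          cycle_operator F x = cycle_operator (lsc_hull F) x &
          is_generalized_cycle (lsc_hull F) x] &
      (* (iii) *)
      orthoproj (orthogonal_complement (diagonal_subspace X m))
        @` classical_cycles (separable_sum f) = [set x]].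
Proof.
move=> F; pose D := diagonal_subspace X m.
have vE : v = - orthoproj D u := hv.
have [Dp up] := diagonal_orthoproj u hm.
have xE : x = u - orthoproj D u by rewrite hx vE.
have Dv : D v by rewrite vE; exact: diagonalN.
have Dxu : D (x - u) by rewrite hx addrC addKr.
have Dx : orthogonal_complement D x by rewrite xE.
have Fu : F x = separable_sum f u := infconv_classical_cycle f_proper hu Dxu.
have Fx0 : cycle_operator F x 0 := cycle_operator_infconv f_proper hu Dxu.
have gx : is_generalized_cycle (lsc_hull F) x.
  exact: generalized_cycle_lsc_hull hu Dxu Dx.
have xP : x = orthoproj (orthogonal_complement D) u.
  by rewrite xE (orthoproj_complement Dp up).
split; first by [].
- split.
    apply: lower_semicontinuous_at_subgradient (iffLR (cycle_operator0 _ _) Fx0).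
    by rewrite Fu (classical_cycleE f_proper hu).1.
  by exists u; rewrite -/F Fu /indicator_fun mem_set// adde0.
- split=> //.
  exact/esym/(cycle_operator_lsc_hull f_proper hu Dxu).
- apply/seteqP; split => [_ [z Zz <-]|_ ->]; last by exists u.
  have [Dq zq] := diagonal_orthoproj z hm.
  rewrite (orthoproj_complement Dq zq).
  have Dzz : D (z - orthoproj D z - z)
    by rewrite addrAC subrr sub0r; exact: diagonalN.
  (* Both projections are the generalized cycle of the same hull. *)
  have gz := generalized_cycle_lsc_hull f_proper hm Zz Dzz zq.
  by rewrite -[[set x]]gx gz.
Qed.
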